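(* Let $k$ be a field. For $n\ge 7$, the dimension pairs of indecomposable triples in the category $\mathcal S_k(n)$ are not contained in any stripe.
   Context: For a field $k$ and $n\ge 1$, $\mathcal S_k(n)$ is the category whose objects are triples $(V,U,T)$ where $V$ is a finite-dimensional $k$-space, $T\colon V\to V$ is a linear operator with $T^n=0$, and $U\subseteq V$ is a subspace with $T(U)\subseteq U$. A map $(V,U,T)\to(V',U',T')$ is a $k$-linear map $f\colon V\to V'$ with $f(U)\subseteq U'$ and $fT=T'f$. Direct sums are formed componentwise; an object is indecomposable if it is non-zero and not isomorphic to a direct sum of two non-zero objects. The dimension pair of $(V,U,T)$ is $(\dim V,\dim U)\in\mathbb Z\times\mathbb Z$. A stripe is the region of the $(v,u)$-plane between two parallel lines, i.e. a set $\{(v,u) : c_1\le av+bu\le c_2\}$ with real $a,b,c_1,c_2$ and $(a,b)\ne(0,0)$. *)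

(* Defs.v *)
From HB Require Import structures.
From mathcomp Require Import all_boot all_order all_algebra.
From mathcomp Require Import boolp classical_sets reals.

Set Implicit Arguments.
Unset Strict Implicit.
Unset Printing Implicit Defensive.

Import Order.TTheory GRing.Theory Num.Theory.
Local Open Scope ring_scope.
Local Open Scope classical_set_scope.

(* oper ^ n = 0 is stated pointwise because the ring structure on endomorphisms
   is not canonical, and does not exist when ambient = 0. *)
Record triple (k : fieldType) (n : nat) := Triple {
  ambient : vectType k;
  subsp : {vspace ambient};
  oper : 'End(ambient);
  oper_nilp : forall v : ambient, iter n oper v = 0;
  subsp_stable : (oper @: subsp <= subsp)%VS
}.

Definition is_map (k : fieldType) (n : nat) (X Y : triple k n)
    (f : 'Hom(ambient X, ambient Y)) : Prop :=
  (f @: subsp X <= subsp Y)%VS /\ (f \o oper X = oper Y \o f)%VF.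

Definition isomorphic (k : fieldType) (n : nat) (X Y : triple k n) : Prop :=
  exists (f : 'Hom(ambient X, ambient Y)) (g : 'Hom(ambient Y, ambient X)),
    [/\ is_map f, is_map g, (g \o f = \1)%VF & (f \o g = \1)%VF].

Section DirectSum.
Variables (k : fieldType) (n : nat) (X Y : triple k n).

Definition dsum_ambient : vectType k := (ambient X * ambient Y)%type.

Definition dsum_fun (p : dsum_ambient) : dsum_ambient :=
  (oper X p.1, oper Y p.2).

Fact dsum_fun_linear : linear dsum_fun.
Proof. by move=> a p q; rewrite /dsum_fun /= !linearP. Qed.

HB.instance Definition _ := @GRing.isLinear.Build k dsum_ambient dsum_ambient
  *:%R dsum_fun dsum_fun_linear.

Definition dsum_oper : 'End(dsum_ambient) := linfun dsum_fun.

Definition dsum_fst : 'Hom(dsum_ambient, ambient X) := linfun fst.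
Definition dsum_snd : 'Hom(dsum_ambient, ambient Y) := linfun snd.

(* The set of pairs (x, y) with x in subsp X and y in subsp Y. *)
Definition dsum_subsp : {vspace dsum_ambient} :=
  (dsum_fst @^-1: subsp X :&: dsum_snd @^-1: subsp Y)%VS.

Fact mem_dsum_subsp (p : dsum_ambient) :
  (p \in dsum_subsp) = (p.1 \in subsp X) && (p.2 \in subsp Y).
Proof. by rewrite memv_cap -!memv_preim !lfunE. Qed.

Fact dsum_nilp (p : dsum_ambient) : iter n dsum_oper p = 0.
Proof.
have E m : iter m dsum_oper p = (iter m (oper X) p.1, iter m (oper Y) p.2).
  by elim: m => [|m IH] /=; [case: p | rewrite IH lfunE].
by rewrite E !oper_nilp.
Qed.

Fact dsum_stable : (dsum_oper @: dsum_subsp <= dsum_subsp)%VS.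
Proof.
apply/subvP => _ /memv_imgP[p pU ->].
move: pU; rewrite !mem_dsum_subsp lfunE /= => /andP[pX pY].
by rewrite (subvP (subsp_stable X)) ?(subvP (subsp_stable Y)) ?memv_img.
Qed.

Definition dsum : triple k n := Triple dsum_nilp dsum_stable.

End DirectSum.

Definition nonzero (k : fieldType) (n : nat) (X : triple k n) : Prop :=
  exists v : ambient X, v <> 0.

Definition indecomposable (k : fieldType) (n : nat) (X : triple k n) : Prop :=
  nonzero X /\
  ~ (exists Y Z : triple k n,
       [/\ nonzero Y, nonzero Z & isomorphic X (dsum Y Z)]).

Definition dim_pair (k : fieldType) (n : nat) (X : triple k n) : int * int :=
  ((\dim (fullv : {vspace ambient X}))%:Z, (\dim (subsp X))%:Z).

Definition indecomposable_dim_pairs (k : fieldType) (n : nat) :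
    set (int * int) :=
  [set p | exists2 X : triple k n, indecomposable X & dim_pair X = p].

Definition plane_point (R : realType) (p : int * int) : R * R :=
  (p.1%:~R, p.2%:~R).

Definition is_stripe (R : realType) (S : set (R * R)) : Prop :=
  exists a b c1 c2 : R, (a, b) <> (0, 0) /\
    S = [set p : R * R | c1 <= a * p.1 + b * p.2 <= c2].

(* Main.v *)
Require Import Defs.
From HB Require Import structures.
From mathcomp Require Import all_boot all_order all_algebra.
From mathcomp Require Import boolp classical_sets reals zify lra.

Set Implicit Arguments.
Unset Strict Implicit.
Unset Printing Implicit Defensive.

Import Order.TTheory GRing.Theory Num.Theory.
Local Open Scope ring_scope.
Local Open Scope classical_set_scope.

(** The idea is to find, already among operators with T^7 = 0, two sequences of
indecomposable triples whose dimension pairs are the multiples m (12, 6) and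
m (13, 6) for all m > 0. A stripe that contains all positive multiples of a
pair is parallel to it, and no stripe is parallel to two independent vectors.

Let W be a vector space with an endomorphism J, and let h >= 2. Take
V = P(h+4) (x) W + P(4) (x) W + P(2) (x) W, where P(p) = k[T]/(T^p), with
generators x w, y w, z w (w in W), and let U be the T-submodule generated by
  u(w) = T^h x w + T y w + z w   and   v(w) = T^2 y w + T z (J w).
Then dim V = (h + 10) dim W and dim U = 6 dim W, and h = 2, 3 give the two
directions. In the degree of z, the kernels and images of powers of T make two
flags of length two, and U makes a third one, so this is the family of
three-flag configurations attached to the extended Dynkin diagram of type E6,
with J as its parameter. Lengthening the longest block by one does not disturb
the configuration: this is what T^7 = 0 allows, and T^6 = 0 does not.

An endomorphism e of (V, U) acts on the heads of the three blocks. As e has to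
respect u(w), it acts on all three by one and the same endomorphism of W, its
symbol (symbol_yx), and as it has to respect v(w), the symbol commutes with J
(symbol_comm). An idempotent e has an idempotent symbol, and if the symbol is
zero then e has image in T V, hence e = e^n has image in T^n V = 0
(idem0_of_symbol, idem_radical). For J a nilpotent Jordan block, the only
idempotents commuting with J are 0 and 1 (shift_commutant_idem), so the only
idempotent endomorphisms of (V, U) are 0 and 1. *)

(** * Truncated polynomials with vector coefficients *)

Section Jets.
Variables (k : fieldType) (W : vectType k) (p : nat).

(** The space of w_0 + w_1 T + ... + w_(p-1) T^(p-1) with w_i in W, that is,
P(p) (x) W. *)
Definition jet : vectType k := {ffun 'I_p -> W}.

(** Total in i, with value 0 for i >= p, so that no bound has to be carried
around when coefficients of different blocks are compared. *)
Definition coef_fun (i : nat) (v : jet) : W :=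
  if insub i is Some j then v j else 0.

Fact coef_fun_linear i : linear (coef_fun i).
Proof.
move=> a u v; rewrite /coef_fun; case: insubP => [j _ _|_]; first by rewrite !ffunE.
by rewrite scaler0 addr0.
Qed.

HB.instance Definition _ i := @GRing.isLinear.Build k jet W *:%R
  (coef_fun i) (coef_fun_linear i).

Definition coef i : 'Hom(jet, W) := linfun (coef_fun i).

Definition jet_of (F : nat -> W) : jet := [ffun i : 'I_p => F i].

Definition gen_fun (w : W) : jet := jet_of (fun i => if i == 0%N then w else 0).

Fact gen_fun_linear : linear gen_fun.
Proof.
move=> a u v; apply/ffunP => i; rewrite !ffunE.
by case: ifP => // _; rewrite scaler0 addr0.
Qed.

HB.instance Definition _ := @GRing.isLinear.Build k W jet *:%R
  gen_fun gen_fun_linear.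

Definition gen : 'Hom(W, jet) := linfun gen_fun.

Definition shift_fun (v : jet) : jet :=
  jet_of (fun i => if i == 0%N then 0 else coef i.-1 v).

Fact shift_fun_linear : linear shift_fun.
Proof.
move=> a u v; apply/ffunP => i; rewrite !ffunE.
by case: ifP => _; rewrite ?linearP // scaler0 addr0.
Qed.

HB.instance Definition _ := @GRing.isLinear.Build k jet jet *:%R
  shift_fun shift_fun_linear.

Definition shift : 'End(jet) := linfun shift_fun.

Lemma coef_ord (i : 'I_p) v : coef i v = v i.
Proof. by rewrite lfunE /= /coef_fun valK. Qed.

Lemma coef_out i v : (p <= i)%N -> coef i v = 0.
Proof. by move=> pi; rewrite lfunE /= /coef_fun insubN // -leqNgt. Qed.

Lemma jet_eqP u v : (forall i, (i < p)%N -> coef i u = coef i v) -> u = v.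
Proof. by move=> uv; apply/ffunP => i; rewrite -!coef_ord uv. Qed.

Lemma coef_jet_of F i : (i < p)%N -> coef i (jet_of F) = F i.
Proof. by move=> ip; rewrite (coef_ord (Ordinal ip)) ffunE. Qed.

Lemma coef_gen i w : (i < p)%N -> coef i (gen w) = if i == 0%N then w else 0.
Proof. by move=> ip; rewrite [gen w]lfunE coef_jet_of. Qed.

Lemma coef_shift i v :
  coef i (shift v) = if (0 < i < p)%N then coef i.-1 v else 0.
Proof.
have [ip|pi] := ltnP i p; last by rewrite coef_out // andbF.
by rewrite [shift v]lfunE coef_jet_of // andbT lt0n -if_neg.
Qed.

Lemma coef_iter_shift j i v :
  coef i (iter j shift v) = if (j <= i < p)%N then coef (i - j) v else 0.
Proof.
elim: j i => [|j IH] i /=.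
  by rewrite subn0; case: ltnP => // /coef_out->.
rewrite coef_shift IH; case: i => //= i; rewrite ltnS subSS.
by case: (ltnP i.+1 p) => [/ltnW->|]; rewrite ?andbT // andbF.
Qed.

Lemma iter_shift0 j : iter j shift 0 = 0.
Proof. by elim: j => //= j ->; rewrite linear0. Qed.

Lemma shift_nilp j v : (p <= j)%N -> iter j shift v = 0.
Proof.
move=> pj; apply: jet_eqP => i ip; rewrite coef_iter_shift linear0.
by rewrite leqNgt (leq_trans ip pj).
Qed.

Lemma coef0_shiftP v : coef 0 v = 0 -> exists u, v = shift u.
Proof.
move=> v0; exists (jet_of (fun i => coef i.+1 v)); apply: jet_eqP => i ip.
rewrite coef_shift; case: i ip => [|i] ip //=; rewrite ip.
by rewrite coef_jet_of // ltnW.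
Qed.

Lemma jet_split v : (0 < p)%N -> exists u, v = gen (coef 0 v) + shift u.
Proof.
move=> p0; have [|u uE] := @coef0_shiftP (v - gen (coef 0 v)).
  by rewrite linearB /= coef_gen ?subrr.
by exists u; rewrite -uE addrC subrK.
Qed.

Lemma dim_jet : \dim (fullv : {vspace jet}) = (p * \dim (fullv : {vspace W}))%N.
Proof. by rewrite !dimvf /dim /= card_ord. Qed.

End Jets.

(** * Idempotents commuting with a nilpotent operator *)

(** From e V in T V one gets e V = e (e V) in T (e V), and so on: e V is in
T^n V = 0. *)
Lemma idem_radical (k : fieldType) (V : vectType k) (T e : 'End(V)) n :
  (forall v, iter n T v = 0) -> (forall v, e (T v) = T (e v)) ->
  (forall v, e (e v) = e v) -> (forall v, exists u, e v = T u) ->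
  forall v, e v = 0.
Proof.
move=> Tn eT ee eV v; have [u ->] : exists u, e v = iter n T u; last exact: Tn.
elim: n {Tn} => [|n [u uE]]; first by exists (e v).
have [u' u'E] := eV u; exists u'; rewrite -ee uE iterSr -u'E.
by elim: n {uE} => //= n IH; rewrite eT IH.
Qed.

(** The algebra of operators commuting with a Jordan block is local: such an
operator acts on the one-dimensional head by a scalar l, and l = l^2 for an
idempotent. *)
Lemma shift_commutant_idem (k : fieldType) m
    (e : 'End(jet (k^o : vectType k) m.+1)) :
  (forall v, e (shift _ _ v) = shift _ _ (e v)) -> (forall v, e (e v) = e v) ->
  (forall v, e v = 0) \/ (forall v, e v = v).
Proof.
move=> eS ee; set W : vectType k := k^o.
pose l : k := coef W m.+1 0 (e (gen W m.+1 1)).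
have c0 v : coef W m.+1 0 (e v) = l * coef W m.+1 0 v.
  have [u {1}->] := jet_split v (ltn0Sn m).
  rewrite [gen _ _ _](_ : _ = coef W m.+1 0 v *: gen W m.+1 1); last first.
    by rewrite -linearZ /= /GRing.scale /= mulr1.
  by rewrite linearD linearZ /= eS linearD linearZ /= coef_shift addr0 mulrC.
have rad (e' : 'End(jet W m.+1)) : (forall v, e' (shift _ _ v) = shift _ _ (e' v)) ->
    (forall v, e' (e' v) = e' v) -> (forall v, coef W m.+1 0 (e' v) = 0) ->
    forall v, e' v = 0.
  move=> e'S e'e' e'0; apply: (idem_radical (n := m.+1)) e'S e'e' _.
    by move=> v; apply: shift_nilp.
  by move=> v; apply: coef0_shiftP.
have /eqP : l * l = l by rewrite -[LHS]c0 ee.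
rewrite -{3}[l]mulr1 -subr_eq0 -mulrBr mulf_eq0 subr_eq0 => /orP[] /eqP lE.
  by left; apply: rad => // v; rewrite c0 lE mul0r.
right=> v; suff: (\1 - e)%VF v = 0.
  by rewrite !(add_lfunE, opp_lfunE, id_lfunE) => /eqP; rewrite subr_eq0 => /eqP.
apply: rad => u; first by rewrite !(add_lfunE, opp_lfunE, id_lfunE) eS linearB.
  by rewrite !(add_lfunE, opp_lfunE, id_lfunE) linearB /= ee subrr subr0.
by rewrite !(add_lfunE, opp_lfunE, id_lfunE) linearB /= c0 lE mul1r subrr.
Qed.

(** * Indecomposability and idempotent endomorphisms *)

Section Projection.
Variables (k : fieldType) (n : nat) (Y Z : triple k n).

Definition proj_fun (p : dsum_ambient Y Z) : dsum_ambient Y Z := (p.1, 0).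

Fact proj_fun_linear : linear proj_fun.
Proof. by move=> a p q; rewrite /proj_fun; congr pair; rewrite /= scaler0 addr0. Qed.

HB.instance Definition _ := @GRing.isLinear.Build k (dsum_ambient Y Z)
  (dsum_ambient Y Z) *:%R proj_fun proj_fun_linear.

Definition proj : 'End(ambient (dsum Y Z)) := linfun proj_fun.

Lemma proj_map : is_map (X := dsum Y Z) (Y := dsum Y Z) proj.
Proof.
split; last by apply/lfunP => p; rewrite !lfunE /= !lfunE /= /proj_fun /dsum_fun /= linear0.
apply/subvP => _ /memv_imgP[p pU ->].
by move: pU; rewrite !mem_dsum_subsp lfunE /= mem0v andbT => /andP[].
Qed.

End Projection.

Lemma is_mapP (k : fieldType) n (X Y : triple k n) (f : 'Hom(ambient X, ambient Y)) :
  is_map f <-> (forall u, u \in subsp X -> f u \in subsp Y) /\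
               (forall v, f (oper X v) = oper Y (f v)).
Proof.
split=> [[fU fT]|[fU fT]]; split.
- by move=> u uX; rewrite (subvP fU) ?memv_img.
- by move=> v; rewrite -!comp_lfunE fT.
- by apply/subvP => _ /memv_imgP[u uX ->]; apply: fU.
- by apply/lfunP => v; rewrite !comp_lfunE.
Qed.

Lemma comp_map (k : fieldType) n (X Y Z : triple k n)
    (f : 'Hom(ambient X, ambient Y)) (g : 'Hom(ambient Y, ambient Z)) :
  is_map f -> is_map g -> is_map (X := X) (Y := Z) (g \o f)%VF.
Proof.
move=> /is_mapP[fU fT] /is_mapP[gU gT]; apply/is_mapP.
by split=> v *; rewrite !comp_lfunE ?fT ?gT // gU ?fU.
Qed.

(** A decomposition of X gives the idempotent endomorphism that projects X onto
the first summand. *)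
Lemma indecomposable_of_idem (k : fieldType) n (X : triple k n) :
  nonzero X ->
  (forall e : 'End(ambient X), is_map (X := X) (Y := X) e ->
     (forall v, e (e v) = e v) -> (forall v, e v = 0) \/ (forall v, e v = v)) ->
  indecomposable X.
Proof.
move=> X0 idem; split=> // -[Y [Z [[y y0] [z z0] [f [g [fm gm /lfunP gf /lfunP fg]]]]]].
have {}gf v : g (f v) = v by have := gf v; rewrite !lfunE.
have {}fg v : f (g v) = v by have := fg v; rewrite comp_lfunE id_lfunE.
pose e := (g \o (proj Y Z \o f))%VF.
have eE v : e v = g ((f v).1, 0) by rewrite !comp_lfunE lfunE.
have ee v : e (e v) = e v by rewrite !eE fg.
have em : is_map (X := X) (Y := X) e.
  by apply: comp_map gm; apply: comp_map fm (@proj_map _ _ Y Z).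
have [e0|e1] := idem e em ee.
  have := e0 (g (y, 0)); rewrite eE fg => /(congr1 f); rewrite fg linear0.
  by case=> /y0.
have := e1 (g (0, z)); rewrite eE fg => /(congr1 f); rewrite !fg.
by case=> /esym/z0.
Qed.

Lemma dim_prodv (k : fieldType) (U V : vectType k) :
  \dim (fullv : {vspace (U * V)%type}) =
  (\dim (fullv : {vspace U}) + \dim (fullv : {vspace V}))%N.
Proof. by rewrite !dimvf. Qed.

(** * The family of triples *)

Section Family.
Variables (k : fieldType) (n h : nat) (hn : (h + 4 <= n)%N) (h2 : (2 <= h)%N).
Variables (W : vectType k) (J : 'End(W)).

Fact picket_stable p : (shift W p @: fullv <= fullv)%VS.
Proof. exact: subvf. Qed.

(** Pickets serve to assemble the operator T on V; the subspace of their direct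
sum is replaced by relU. *)
Definition picket p (pn : (p <= n)%N) : triple k n :=
  Triple (fun v => @shift_nilp k W p n v pn) (@picket_stable p).

Fact le4n : (4 <= n)%N. Proof. exact: leq_trans (leq_addl h 4) hn. Qed.
Fact le2n : (2 <= n)%N. Proof. exact: leq_trans le4n. Qed.

Let A := picket hn.
Let B := picket le4n.
Let C := picket le2n.

Definition pickets := dsum (dsum A B) C.

Let V := ambient pickets.
Let T : 'End(V) := oper pickets.

Definition xc i : 'Hom(V, W) :=
  (coef W (h + 4) i \o (dsum_fst A B \o dsum_fst (dsum A B) C))%VF.
Definition yc i : 'Hom(V, W) :=
  (coef W 4 i \o (dsum_snd A B \o dsum_fst (dsum A B) C))%VF.
Definition zc i : 'Hom(V, W) := (coef W 2 i \o dsum_snd (dsum A B) C)%VF.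

Lemma xcE i v : xc i v = coef W (h + 4) i v.1.1.
Proof. by rewrite comp_lfunE; congr (coef _ _ _ _); rewrite comp_lfunE !lfunE. Qed.
Lemma ycE i v : yc i v = coef W 4 i v.1.2.
Proof. by rewrite comp_lfunE; congr (coef _ _ _ _); rewrite comp_lfunE !lfunE. Qed.
Lemma zcE i v : zc i v = coef W 2 i v.2.
Proof. by rewrite comp_lfunE; congr (coef _ _ _ _); rewrite lfunE. Qed.

Definition xg w : V := (gen W (h + 4) w, 0, 0).
Definition yg w : V := (0, gen W 4 w, 0).
Definition zg w : V := (0, 0, gen W 2 w).

Lemma TE v : T v = (shift W (h + 4) v.1.1, shift W 4 v.1.2, shift W 2 v.2).
Proof. by rewrite /T lfunE /= /dsum_fun /= lfunE. Qed.

Lemma iterTE i v :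
  iter i T v = (iter i (shift W (h + 4)) v.1.1, iter i (shift W 4) v.1.2,
                iter i (shift W 2) v.2).
Proof. by elim: i => [|i IH] /=; [case: v => [[]] | rewrite IH TE]. Qed.

Lemma xc_iter j i v :
  xc i (iter j T v) = if (j <= i < h + 4)%N then xc (i - j) v else 0.
Proof. by rewrite !xcE iterTE coef_iter_shift. Qed.
Lemma yc_iter j i v :
  yc i (iter j T v) = if (j <= i < 4)%N then yc (i - j) v else 0.
Proof. by rewrite !ycE iterTE coef_iter_shift. Qed.
Lemma zc_iter j i v :
  zc i (iter j T v) = if (j <= i < 2)%N then zc (i - j) v else 0.
Proof. by rewrite !zcE iterTE coef_iter_shift. Qed.

(** An element sum_i T^i u(w_i) + sum_j T^j v(w'_j) of U has w_i = x_(h+i) and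
w'_0 = y_2 - x_(h+1); eliminating these parameters leaves the equations on the
remaining coefficients whose defects are collected here. Presenting U by
equations makes membership easy to exploit, and their independence gives
dim U. *)
Definition defect_codom : vectType k := (jet W h * W * W * W * W)%type.

Definition defect_fun (v : V) : defect_codom :=
  (jet_of h (fun i => xc i v), yc 0 v, (yc 1 - xc h) v,
   (zc 0 - xc h) v, (zc 1 - xc h.+1 - (J \o (yc 2 - xc h.+1))%VF) v).

Lemma defect_funE v : defect_fun v =
  (jet_of h (fun i => xc i v), yc 0 v, yc 1 v - xc h v, zc 0 v - xc h v,
   zc 1 v - xc h.+1 v - J (yc 2 v - xc h.+1 v)).
Proof. by rewrite /defect_fun !(add_lfunE, opp_lfunE, comp_lfunE). Qed.

Fact defect_fun_linear : linear defect_fun.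
Proof.
move=> a u v; rewrite /defect_fun; congr (_, _, _, _, _); try exact: linearP.
by apply/ffunP => i; rewrite !ffunE linearP.
Qed.

HB.instance Definition _ := @GRing.isLinear.Build k V defect_codom *:%R
  defect_fun defect_fun_linear.

Definition relU : {vspace V} := lker (linfun defect_fun).

Definition in_rel v := [/\ forall i, (i < h)%N -> xc i v = 0, yc 0 v = 0,
   yc 1 v = xc h v, zc 0 v = xc h v &
   zc 1 v - xc h.+1 v = J (yc 2 v - xc h.+1 v)].

Lemma relUP v : reflect (in_rel v) (v \in relU).
Proof.
rewrite memv_ker lfunE /= defect_funE; apply: (iffP eqP) => [[]|].
  move=> /ffunP x0 y0 /eqP + /eqP + /eqP; rewrite !subr_eq0.
  move=> /eqP y1 /eqP z0 /eqP z1; split=> // i ih.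
  by have := x0 (Ordinal ih); rewrite !ffunE.
case=> x0 y0 y1 z0 z1; rewrite y0 y1 z0 z1 !subrr.
by congr (_, _, _, _, _); apply/ffunP => i; rewrite !ffunE x0.
Qed.

Fact relU_stable : (T @: relU <= relU)%VS.
Proof.
apply/subvP => _ /memv_imgP[v /relUP[x0 y0 y1 z0 z1] ->].
have xs i := xc_iter 1 i v; have ys i := yc_iter 1 i v.
have zs i := zc_iter 1 i v; rewrite /= in xs ys zs.
apply/relUP; split.
- by move=> i ih; rewrite xs; case: ifP => // _; rewrite x0 // (leq_ltn_trans (leq_subr _ _)).
- by rewrite ys.
- by rewrite ys xs y0 x0 ?if_same // subn1 prednK // ltnW.
- by rewrite zs xs x0 ?if_same // subn1 prednK // ltnW.
have h4 : (h.+1 < h + 4)%N by lia.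
rewrite zs ys !xs /= h4 !subn1 /= y1 z0.
by rewrite !subrr linear0.
Qed.

Definition member : triple k n := Triple (@oper_nilp _ _ pickets) relU_stable.

(** The equations can be solved with arbitrary right-hand sides by taking
x_h = x_(h+1) = y_2 = 0, so dim U = (h + 10) dim W - (h + 4) dim W. *)
Lemma dim_relU : \dim relU = (6 * \dim (fullv : {vspace W}))%N.
Proof.
have := limg_ker_dim (linfun defect_fun) fullv; rewrite capfv -/relU.
have -> : (linfun defect_fun @: fullv)%VS = fullv.
  apply/eqP; rewrite eqEsubv subvf /=; apply/subvP => -[[[[a b] c] d] e] _.
  pose v : V := (jet_of (h + 4) (fun i => coef W h i a),
    jet_of 4 (nth 0 [:: b; c]), jet_of 2 (nth 0 [:: d; e])).
  have xi i : (i < h + 4)%N -> xc i v = coef W h i a.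
    by move=> ih; rewrite xcE coef_jet_of.
  apply/memv_imgP; exists v; first exact: memvf.
  rewrite lfunE /= defect_funE !xi; try lia.
  rewrite !ycE !zcE /= !coef_jet_of //= !coef_out ?leqnSn // !subr0 linear0 subr0.
  congr (_, _, _, _, _); apply: jet_eqP => i ih.
  by rewrite coef_jet_of // xi // ltn_addr.
rewrite /defect_codom /V /= /dsum_ambient /= /dsum_ambient /= !dim_prodv !dim_jet; lia.
Qed.

Lemma dim_pair_member :
  dim_pair member = (((h + 10) * \dim (fullv : {vspace W}))%N%:Z,
                     (6 * \dim (fullv : {vspace W}))%N%:Z).
Proof.
rewrite /dim_pair dim_relU; congr (_%:Z, _).
rewrite /= /dsum_ambient /= /dsum_ambient /= !dim_prodv !dim_jet; lia.
Qed.

Fact zg_linear : linear zg.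
Proof.
by move=> a u v; rewrite /zg linearP; congr (_, _, _); rewrite /= scaler0 addr0.
Qed.

HB.instance Definition _ := @GRing.isLinear.Build k W V *:%R zg zg_linear.

Lemma xc_xg i w : (i < h + 4)%N -> xc i (xg w) = if i == 0%N then w else 0.
Proof. by move=> ih; rewrite xcE coef_gen. Qed.
Lemma xc_yg i w : xc i (yg w) = 0. Proof. by rewrite xcE linear0. Qed.
Lemma xc_zg i w : xc i (zg w) = 0. Proof. by rewrite xcE linear0. Qed.
Lemma yc_xg i w : yc i (xg w) = 0. Proof. by rewrite ycE linear0. Qed.
Lemma yc_yg i w : (i < 4)%N -> yc i (yg w) = if i == 0%N then w else 0.
Proof. by move=> ih; rewrite ycE coef_gen. Qed.
Lemma yc_zg i w : yc i (zg w) = 0. Proof. by rewrite ycE linear0. Qed.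
Lemma zc_xg i w : zc i (xg w) = 0. Proof. by rewrite zcE linear0. Qed.
Lemma zc_yg i w : zc i (yg w) = 0. Proof. by rewrite zcE linear0. Qed.
Lemma zc_zg i w : (i < 2)%N -> zc i (zg w) = if i == 0%N then w else 0.
Proof. by move=> ih; rewrite zcE coef_gen. Qed.

Lemma xg0 : xg 0 = 0. Proof. by rewrite /xg linear0. Qed.
Lemma yg0 : yg 0 = 0. Proof. by rewrite /yg linear0. Qed.
Lemma zg0 : zg 0 = 0. Proof. exact: linear0. Qed.

Lemma top_split v :
  exists u, v = xg (xc 0 v) + yg (yc 0 v) + zg (zc 0 v) + T u.
Proof.
have [|a aE] := jet_split v.1.1; first by rewrite addn4.
have [//|b bE] := jet_split v.1.2; have [//|c cE] := jet_split v.2.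
exists (a, b, c); rewrite TE xcE ycE zcE /=.
rewrite [LHS](_ : _ = (v.1.1, v.1.2, v.2)); last by case: (v) => [[]].
rewrite {1}aE {1}bE {1}cE /xg /yg /zg.
by congr (_, _, _); rewrite /= ?add0r ?addr0.
Qed.

(** Writing the summands as iterates of T, even for the exponents 0 and 1, lets
the same coefficient formulas apply to all of them. *)
Definition ugen w : V := iter h T (xg w) + iter 1 T (yg w) + iter 0 T (zg w).
Definition vgen w : V := iter 2 T (yg w) + iter 1 T (zg (J w)).

Let xcD i u v : xc i (u + v) = xc i u + xc i v. Proof. exact: linearD. Qed.
Let ycD i u v : yc i (u + v) = yc i u + yc i v. Proof. exact: linearD. Qed.
Let zcD i u v : zc i (u + v) = zc i u + zc i v. Proof. exact: linearD. Qed.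

Let coefE := (xcD, ycD, zcD, xc_iter, yc_iter, zc_iter,
  xc_yg, xc_zg, yc_xg, yc_zg, zc_xg, zc_yg).

(* Discards the branches of conditionals on arithmetic bounds that cannot occur. *)
Ltac ifs := repeat (case: ifPn => ?; try (exfalso; lia)).

Lemma ugen_in w : ugen w \in relU.
Proof.
apply/relUP; split=> [i ih||||]; rewrite /ugen !coefE /=.
all: ifs; rewrite ?subn0 ?addr0 ?add0r ?subSnn ?subnn //.
- by rewrite xc_xg ?yc_yg //; lia.
- by rewrite xc_xg ?zc_zg //; lia.
all: by rewrite xc_xg ?zc_zg ?yc_yg ?subrr ?linear0 //; lia.
Qed.

Lemma vgen_in w : vgen w \in relU.
Proof.
apply/relUP; split=> [i ih||||]; rewrite /vgen !coefE /=.
all: ifs; rewrite ?subn0 ?addr0 ?add0r //.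
by rewrite !subr0 zc_zg ?yc_yg.
Qed.

Lemma iter_yg w : iter 4 T (yg w) = 0.
Proof. by rewrite iterTE !iter_shift0 shift_nilp. Qed.

Lemma iter_zg w : iter 2 T (zg w) = 0.
Proof. by rewrite iterTE !iter_shift0 shift_nilp. Qed.

Section Endo.
Variables (e : 'End(V)).
Hypotheses (eT : forall v, e (T v) = T (e v))
  (eU : forall u, u \in relU -> e u \in relU).

Let e_iter j v : e (iter j T v) = iter j T (e v).
Proof. by elim: j => //= j IH; rewrite eT IH. Qed.

Let eD u v : e (u + v) = e u + e v. Proof. exact: linearD. Qed.

(** The next three lemmas: e (y w) is killed by T^4 and e (z w) by T^2, as y w
and z w are, so their components in longer blocks lie deep. *)
Lemma xc_e_yg i w : (i < h)%N -> xc i (e (yg w)) = 0.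
Proof.
move=> ih; have := xc_iter 4 (i + 4) (e (yg w)).
by rewrite -e_iter iter_yg !linear0 addnK => ->; ifs.
Qed.

Lemma xc_e_zg i w : (i < h + 2)%N -> xc i (e (zg w)) = 0.
Proof.
move=> ih; have := xc_iter 2 (i + 2) (e (zg w)).
by rewrite -e_iter iter_zg !linear0 addnK => ->; ifs.
Qed.

Lemma yc_e_zg i w : (i < 2)%N -> yc i (e (zg w)) = 0.
Proof.
move=> ih; have := yc_iter 2 (i + 2) (e (zg w)).
by rewrite -e_iter iter_zg !linear0 addnK => ->; ifs.
Qed.

(** The action of e on the head of the block P(2) (x) W. *)
Definition symbol : 'End(W) := (zc 0 \o (e \o linfun zg))%VF.

Lemma symbolE w : symbol w = zc 0 (e (zg w)).
Proof. by rewrite 2!comp_lfunE [X in e X]lfunE. Qed.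

(** Compares the coefficients of x at T^h, of y at T and of z at 1 in
e (u(w)): they are the actions of e on the three heads, and they agree for
elements of U. *)
Lemma symbol_yx w :
  yc 0 (e (yg w)) = symbol w /\ xc 0 (e (xg w)) = symbol w.
Proof.
have /relUP[_ _ + + _] := eU (ugen_in w).
rewrite !eD !e_iter !coefE symbolE.
ifs; rewrite /= subnn !subn0 subn1 (xc_e_yg (i := h.-1)) ?xc_e_zg ?yc_e_zg; try lia.
by rewrite !addr0 !add0r subnn => -> <-.
Qed.

(** In e (v(w)) the coefficients of x at T^h and T^(h+1) vanish, so membership in
U says that the coefficient of z at T is J applied to that of y at T^2. *)
Lemma symbol_comm w : symbol (J w) = J (symbol w).
Proof.
have /relUP[_ _ _ _] := eU (vgen_in w).
rewrite !eD !e_iter !coefE.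
ifs.
rewrite ?subnn ?subn0 ?addr0 ?add0r !subSS subn0 (xc_e_zg (i := h)); try lia.
rewrite ?xc_e_yg ?yc_e_zg ?addr0 ?subr0; try lia.
by rewrite (symbol_yx w).1 [symbol (J w)]symbolE.
Qed.

Lemma zc0T v : zc 0 (T v) = 0. Proof. exact: (zc_iter 1). Qed.

Hypothesis ee : forall v, e (e v) = e v.

Lemma symbol_idem w : symbol (symbol w) = symbol w.
Proof.
rewrite [in RHS]symbolE -ee; have [u ->] := top_split (e (zg w)).
rewrite xc_e_zg ?yc_e_zg //; last lia.
by rewrite -symbolE xg0 yg0 !add0r eD zcD eT zc0T addr0 -symbolE.
Qed.

(** Modulo T V, an e with zero symbol is strictly triangular: it sends z to 0, y
into the span of z, and x into the span of y and z. Being idempotent, it then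
has image in T V. *)
Lemma idem0_of_symbol : (forall w, symbol w = 0) -> forall v, e v = 0.
Proof.
move=> s0.
have ez w : exists u, e (zg w) = T u.
  have [u ->] := top_split (e (zg w)); exists u.
  by rewrite xc_e_zg ?yc_e_zg -?symbolE ?s0 ?xg0 ?yg0 ?zg0 ?add0r //; lia.
have ey w : exists u, e (yg w) = T u.
  have [u uE] := top_split (e (yg w)); have [u' u'E] := ez (zc 0 (e (yg w))).
  exists (u' + e u).
  rewrite -ee uE (symbol_yx w).1 s0 xc_e_yg; last by lia.
  by rewrite xg0 yg0 !add0r eD eT u'E linearD.
have ex w : exists u, e (xg w) = T u.
  have [u uE] := top_split (e (xg w)); have [u' u'E] := ez (zc 0 (e (xg w))).
  have [u'' u''E] := ey (yc 0 (e (xg w))).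
  exists (u'' + u' + e u).
  by rewrite -ee uE (symbol_yx w).2 s0 xg0 add0r !eD eT u'E u''E !linearD.
apply: (idem_radical (n := n)) eT ee _; first exact: (oper_nilp (t := pickets)).
move=> v; have [u ->] := top_split v.
have [u1 u1E] := ex (xc 0 v); have [u2 u2E] := ey (yc 0 v).
have [u3 u3E] := ez (zc 0 v); exists (u1 + u2 + u3 + e u).
by rewrite !eD eT u1E u2E u3E !linearD.
Qed.
End Endo.

(** If the symbol of e is 1, the argument for symbol 0 applies to 1 - e. *)
Lemma indecomposable_member :
  (exists w : W, w <> 0) ->
  (forall a : 'End(W), (forall w, a (J w) = J (a w)) -> (forall w, a (a w) = a w) ->
     (forall w, a w = 0) \/ (forall w, a w = w)) ->
  indecomposable member.
Proof.
move=> [w w0] Jidem; apply: indecomposable_of_idem.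
  exists (zg w) => zg0'; apply: w0.
  have := congr1 (zc 0) zg0'; rewrite zc_zg //= => ->; exact: linear0.
move=> e /is_mapP[eU eT] ee.
have [] := Jidem (symbol e) (symbol_comm eT eU) (symbol_idem eT ee) => s.
  by left; exact: (idem0_of_symbol eT eU ee).
right=> v; suff: (\1 - e)%VF v = 0.
  by rewrite !(add_lfunE, opp_lfunE, id_lfunE) => /eqP; rewrite subr_eq0 => /eqP.
apply: idem0_of_symbol => {v} [v|v vU|v|x].
- by rewrite !(add_lfunE, opp_lfunE, id_lfunE) eT linearB.
- by rewrite !(add_lfunE, opp_lfunE, id_lfunE) rpredB // eU.
- by rewrite !(add_lfunE, opp_lfunE, id_lfunE) linearB /= ee subrr subr0.
rewrite symbolE !(add_lfunE, opp_lfunE, id_lfunE) linearB /= -symbolE (s x) zc_zg //.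
exact: subrr.
Qed.

End Family.

Lemma indecomposable_pair (k : fieldType) n h m :
  (2 <= h)%N -> (h + 4 <= n)%N ->
  indecomposable_dim_pairs k n (((h + 10) * m.+1)%N%:Z, (6 * m.+1)%N%:Z).
Proof.
move=> h2 hn; pose W := jet (k^o : vectType k) m.+1.
exists (member hn h2 (shift _ _ : 'End(W))).
  apply: indecomposable_member; last exact: shift_commutant_idem.
  exists (gen (k^o : vectType k) m.+1 1) => /(congr1 (coef (k^o : vectType k) m.+1 0)).
  by rewrite coef_gen // linear0 => /eqP; rewrite oner_eq0.
by rewrite dim_pair_member dim_jet dimvf /dim /= muln1.
Qed.

(** * Stripes *)

Lemma bounded_multiples (R : realType) (s c1 c2 : R) :
  (forall m : nat, c1 <= s * m.+1%:R <= c2) -> s = 0.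
Proof.
move=> bnd; apply/eqP/negPn/negP => s0.
pose c := `|c1| + `|c2|.
have c0 : 0 <= c / `|s| by rewrite divr_ge0 ?addr_ge0.
have := archi_boundP c0; rewrite ltr_pdivrMr ?normr_gt0 // => /lt_geF/negP; apply.
set m := Num.bound _; have /andP[b1 b2] := bnd m.
rewrite mulrC; apply: (@le_trans _ _ `|s * m.+1%:R|).
  by rewrite normrM ler_wpM2l // normr_nat ler_nat.
have n1 := ler_norm (- c1); have n2 := ler_norm c2; rewrite normrN in n1.
have p1 := normr_ge0 c1; have p2 := normr_ge0 c2.
by rewrite ler_norml /c; apply/andP; split; lra.
Qed.

Theorem mainTheorem13 (R : realType) (k : fieldType) (n : nat)
    (hn : (7 <= n)%N) (S : set (R * R)) :
  is_stripe S ->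
  ~ ([set plane_point R p | p in indecomposable_dim_pairs k n] `<=` S).
Proof.
move=> [a [b [c1 [c2 [ab ->]]]]] sub.
have line h : (2 <= h)%N -> (h + 4 <= n)%N -> a * (h + 10)%:R + b * 6%:R = 0.
  move=> h2 hn'; apply: (@bounded_multiples _ _ c1 c2) => m.
  have /sub/= := imageP (plane_point R) (@indecomposable_pair k n h m h2 hn').
  by rewrite -!pmulrn !natrM !mulrA -mulrDl.
have e2 := line 2%N isT (ltnW hn); have e3 := line 3%N isT hn.
have a0 : a = 0 by lra.
by apply: ab; congr pair => //; lra.
Qed.
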